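(* Let $d\ge 1$ and let $C\subseteq\mathbb{R}^d$ be a set of size $n\le 4$. Then $\Psi(C)$ is exactly the set of protrusive orderings of $C$.
   Context: For a finite multiset $V$ of points in $\mathbb{R}^d$, $D_V(x)=\sum_{v\in V}\|x-v\|$ (Euclidean norm, with multiplicity). $V$ distinguishes $C$ if the values $D_V(c)$, $c\in C$, are pairwise distinct, and then witnesses the ordering of $C$ by increasing $D_V$-value. $\Psi(C)$ is the set of all orderings of $C$ witnessed by finite nonempty multisets $V\subseteq\mathbb{R}^d$ distinguishing $C$. An ordering $(x_1,\dots,x_n)$ is protrusive if for every $i\in[n-1]$, $x_{i+1}$ is not in the convex hull of $x_1,\dots,x_i$. *)

(* Defs.v *)
From HB Require Import structures.
From mathcomp Require Import all_boot all_order all_algebra.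
From mathcomp Require Import finmap multiset.
From mathcomp Require Import boolp classical_sets reals convex.

Set Implicit Arguments.
Unset Strict Implicit.
Unset Printing Implicit Defensive.

Import Order.TTheory GRing.Theory Num.Theory.

Local Open Scope classical_set_scope.
Local Open Scope ring_scope.

(* The library norm on 'rV[R]_d is the sup norm. *)
Definition enorm (R : realType) (d : nat) (x : 'rV[R]_d) : R :=
  Num.sqrt (\sum_(i < d) (x ord0 i) ^+ 2).

(* [enum_mset V] lists the elements of V with multiplicity. *)
Definition dist_sum (R : realType) (d : nat) (V : {mset 'rV[R]_d}%mset)
    (x : 'rV[R]_d) : R :=
  \sum_(v <- enum_mset V) enorm (x - v).

Definition distinguishes (R : realType) (d : nat)
    (V : {mset 'rV[R]_d}%mset) (C : {fset 'rV[R]_d}) : Prop :=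
  {in C &, injective (dist_sum V)}.

Definition ordering (R : realType) (d : nat) (C : {fset 'rV[R]_d})
    (s : seq 'rV[R]_d) : Prop :=
  uniq s /\ s =i C.

Definition witnesses (R : realType) (d : nat) (V : {mset 'rV[R]_d}%mset)
    (C : {fset 'rV[R]_d}) (s : seq 'rV[R]_d) : Prop :=
  [/\ distinguishes V C, ordering C s &
      sorted (fun x y => dist_sum V x < dist_sum V y) s].

Definition Psi (R : realType) (d : nat) (C : {fset 'rV[R]_d}) :
    set (seq 'rV[R]_d) :=
  [set s | exists V : {mset 'rV[R]_d}%mset, V <> mset0 /\ witnesses V C s].

Definition convex_hull (R : realType) (d : nat) (A : set 'rV[R]_d) :
    set 'rV[R]_d :=
  smallest (@convex_set R 'rV[R]_d) A.

(* With 0-based indexing, x_{i+1} is [nth 0 s i] and x_1, ..., x_i are the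
   entries of [take i s]; i ranges over 1 <= i <= n - 1. *)
Definition protrusive (R : realType) (d : nat) (s : seq 'rV[R]_d) : Prop :=
  forall i : nat, (0 < i < size s)%N ->
    ~ convex_hull [set x | x \in take i s] (nth 0 s i).

(* Main.v *)
Require Import Defs.
From mathcomp Require Import all_boot all_order all_algebra.
From mathcomp Require Import finmap multiset.
From mathcomp Require Import boolp classical_sets reals convex.
From mathcomp Require Import interval_inference ring lra.

(** Convexity of [D_V] gives one inclusion. For the other, add points to reach
    [n = 4] and look at the increments
    [(D_V x2 - D_V x1, D_V x3 - D_V x2, D_V x4 - D_V x3)]: they form an additive
    semigroup in [R^3]. If it misses the open positive octant, some nonzero
    [(a, b, c) >= 0] is nonpositive on it, i.e.
    [- a |x1 - v| + (a - b) |x2 - v| + (b - c) |x3 - v| + c |x4 - v| <= 0]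
    for all [v]. Sending [v] to infinity shows that these four coefficients,
    which sum to [0], are an affine dependence of the [xi]. Taking [v = x1]
    (and, for the sign pattern [-+-+], also [v = x3]) then forces equality in a
    triangle inequality, which puts some [x(i+1)] in the hull of [x1..xi]. *)

Set Implicit Arguments.
Unset Strict Implicit.
Unset Printing Implicit Defensive.

Import Order.TTheory GRing.Theory Num.Theory.

Local Open Scope classical_set_scope.
Local Open Scope ring_scope.

(** * Theorems of the alternative for additive semigroups of real vectors *)

Section Alternative.
Variable R : realType.
Implicit Types p q r s t a b c : R.

(** If a vector up and to the left and one down and to the right had a positive combination in the
    open quadrant, an integer combination would land there too. So the slopes on the two sides are
    ordered, and an infimum of slopes gives the normal of a separating line. *)
Lemma semigroup_alternative2 (S : R -> R -> Prop) :
  (forall p q p' q', S p q -> S p' q' -> S (p + p') (q + q')) ->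
  (forall p q, S p q -> 0 < p -> q <= 0) ->
  exists s t, [/\ 0 <= s, 0 <= t, 0 < s + t &
    forall p q, S p q -> s * p + t * q <= 0].
Proof.
move=> SD Sneg.
have SM n p q : S p q -> S (n.+1%:R * p) (n.+1%:R * q).
  move=> Spq; elim: n => [|n IHn]; first by rewrite !mul1r.
  by rewrite -[n.+2]addn1 natrD !mulrDl !mul1r; exact: SD.
have slopes p q p' q' : S p q -> S p' q' -> 0 < q -> 0 < p' -> q * p' <= p * q'.
  move=> Spq Spq' q0 p'0; rewrite leNgt; apply/negP => lt_slope.
  have q'0 := Sneg _ _ Spq' p'0.
  have p0 : p <= 0.
    by rewrite leNgt; apply/negP => /(Sneg _ _ Spq); rewrite leNgt q0.
  (* [n] makes [n+1] copies of [e] outweigh [- q' * p']. Then [m+1] is the least number of copies of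
     [p'] exceeding [n+1] copies of [- p], with an excess of at most [p']. The resulting combination
     has both coordinates positive. *)
  pose e := q * p' - p * q'; have e0 : 0 < e by rewrite subr_gt0.
  pose n := Num.truncn (- q' * p' / e).
  have nE : - q' * p' < n.+1%:R * e by rewrite -ltr_pdivrMr// truncnS_gt.
  have np0 : 0 <= n.+1%:R * - p / p'.
    by rewrite divr_ge0 ?mulr_ge0 ?oppr_ge0// ltW.
  pose m := Num.truncn (n.+1%:R * - p / p').
  have mgt : n.+1%:R * - p < m.+1%:R * p' by rewrite -ltr_pdivrMr// truncnS_gt.
  have mle : m.+1%:R * p' <= n.+1%:R * - p + p'.
    by rewrite -natr1 mulrDl mul1r lerD2r -ler_pdivlMr// truncn_le.
  have := Sneg _ _ (SD _ _ _ _ (SM n _ _ Spq) (SM m _ _ Spq')).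
  have pos1 : 0 < n.+1%:R * p + m.+1%:R * p' by lra.
  move=> /(_ pos1); rewrite leNgt => /negP; apply.
  rewrite -(pmulr_lgt0 _ p'0).
  have := ler_wpM2l (_ : 0 <= - q') mle; rewrite oppr_ge0 => /(_ q'0).
  rewrite /e in nE; nra.
case: (pselect (exists p q, S p q /\ 0 < p)) => [[p0 [q0 [S0 p0gt0]]]|noP].
  (* With [t = 1], the weight [s] must be at most [- q / p] where [p > 0] and at least [q / - p]
     where [p < 0 < q]. [inf F] is the largest value meeting the first demand; [slopes] yields the
     second. *)
  pose F := [set - u.2 / u.1 | u in [set u : R * R | S u.1 u.2 /\ 0 < u.1]].
  have F0 : lbound F 0.
    move=> _ [[p q] /= [Spq p0'] <-].
    by rewrite divr_ge0 ?oppr_ge0 ?(Sneg _ _ Spq)// ltW.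
  have Fn : F !=set0 by exists (- q0 / p0), (p0, q0).
  have th0 : 0 <= inf F by apply: lb_le_inf.
  exists (inf F), 1; split => //; first by rewrite ltr_wpDl.
  move=> p q Spq; rewrite mul1r.
  case: (ltP 0 p) => [pgt0|ple0].
    have : inf F <= - q / p by apply: ge_inf; [exists 0|exists (p, q)].
    by rewrite ler_pdivlMr// => ?; lra.
  case: (ltP 0 q) => [qgt0|qle0]; last by have := mulr_ge0_le0 th0 ple0; lra.
  have plt0 : p < 0.
    rewrite lt_neqAle ple0 andbT; apply/eqP => p00.
    have := slopes _ _ _ _ Spq S0 qgt0 p0gt0.
    by rewrite p00 mul0r leNgt mulr_gt0.
  have : q / - p <= inf F.
    apply: lb_le_inf => // _ [[p' q'] /= [Spq' p'0] <-].
    rewrite ler_pdivrMr ?oppr_gt0// mulrAC ler_pdivlMr//.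
    by have := slopes _ _ _ _ Spq Spq' qgt0 p'0; lra.
  by rewrite ler_pdivrMr ?oppr_gt0// => ?; lra.
exists 1, 0; split; rewrite ?addr0// => p q Spq.
rewrite mul1r mul0r addr0 leNgt; apply/negP => p0.
by apply: noP; exists p, q.
Qed.

(* Eliminate the last two coordinates on the part where [p > 0], which merges
   them into [s * q + t * r], and then apply the planar case again. *)
Lemma semigroup_alternative3 (S : R -> R -> R -> Prop) :
  (forall p q r p' q' r', S p q r -> S p' q' r' ->
     S (p + p') (q + q') (r + r')) ->
  (forall p q r, S p q r -> 0 < p -> 0 < q -> r <= 0) ->
  exists a b c, [/\ 0 <= a, 0 <= b, 0 <= c, 0 < a + b + c &
    forall p q r, S p q r -> a * p + b * q + c * r <= 0].
Proof.
move=> SD Sneg.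
have [||s [t [s0 t0 st0 stS]]] :=
    @semigroup_alternative2 (fun q r => exists2 p, S p q r & 0 < p).
- move=> q r q' r' [p Sp p0] [p' Sp' p'0].
  by exists (p + p'); [exact: SD|exact: addr_gt0].
- by move=> q r [p Sp p0]; exact: Sneg Sp p0.
have [||a [b [a0 b0 ab0 abS]]] :=
    @semigroup_alternative2 (fun p u => exists q r, S p q r /\ u = s * q + t * r).
- move=> p u p' u' [q [r [Sp ->]]] [q' [r' [Sp' ->]]].
  by exists (q + q'), (r + r'); split; [exact: SD|ring].
- by move=> p _ [q [r [Sp ->]]] p0; apply: stS; exists p.
exists a, (b * s), (b * t); split; rewrite ?mulr_ge0//.
  have [b00|bn0] := eqVneq b 0; first by move: ab0; rewrite b00 !mul0r !addr0.
  rewrite -addrA -mulrDr ltr_wpDl// mulr_gt0// lt_neqAle eq_sym bn0//.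
move=> p q r Sp; have := abS p _ (ex_intro _ q (ex_intro _ r (conj Sp erefl))).
by rewrite mulrDr !mulrA addrA.
Qed.

End Alternative.

(** * The Euclidean norm: equality in the triangle inequality and behaviour at infinity *)

Section Euclidean.
Variables (R : realType) (d : nat).
Implicit Types (x y z u v : 'rV[R]_d) (a b c t : R).

Definition dot x y : R := \sum_(i < d) x ord0 i * y ord0 i.

Lemma dotC x y : dot x y = dot y x.
Proof. by apply: eq_bigr => i _; rewrite mulrC. Qed.

Lemma dotDl x y z : dot (x + y) z = dot x z + dot y z.
Proof. by rewrite -big_split; apply: eq_bigr => i _; rewrite mxE mulrDl. Qed.

Lemma dotZl a x y : dot (a *: x) y = a * dot x y.
Proof. by rewrite mulr_sumr; apply: eq_bigr => i _; rewrite mxE mulrA. Qed.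

Lemma dotDr x y z : dot z (x + y) = dot z x + dot z y.
Proof. by rewrite dotC dotDl !(dotC z). Qed.

Lemma dotZr a x y : dot x (a *: y) = a * dot x y.
Proof. by rewrite dotC dotZl dotC. Qed.

Lemma dotNl x y : dot (- x) y = - dot x y.
Proof. by rewrite -scaleN1r dotZl mulN1r. Qed.

Lemma dotNr x y : dot x (- y) = - dot x y.
Proof. by rewrite dotC dotNl dotC. Qed.

Lemma dot_suml I (r : seq I) (F : I -> 'rV[R]_d) y :
  dot (\sum_(i <- r) F i) y = \sum_(i <- r) dot (F i) y.
Proof.
elim: r => [|i r IHr]; last by rewrite !big_cons dotDl IHr.
by rewrite !big_nil -(scale0r 0) dotZl mul0r.
Qed.

Definition dotE := (dotDl, dotDr, dotZl, dotZr, dotNl, dotNr).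

Lemma dot_ge0 x : 0 <= dot x x.
Proof. by apply: sumr_ge0 => i _; rewrite -expr2 sqr_ge0. Qed.

Lemma dot_eq0 x : dot x x = 0 -> x = 0.
Proof.
move=> /eqP; rewrite psumr_eq0 => [/allP x0|i _]; last by rewrite -expr2 sqr_ge0.
apply/rowP => i; rewrite mxE; apply/eqP.
by have := x0 i; rewrite mem_index_enum -expr2 sqrf_eq0; apply.
Qed.

Lemma enormE x : enorm x = Num.sqrt (dot x x).
Proof. by congr Num.sqrt; apply: eq_bigr => i _; rewrite expr2. Qed.

Lemma enorm_sqr x : enorm x ^+ 2 = dot x x.
Proof. by rewrite enormE sqr_sqrtr ?dot_ge0. Qed.

Lemma enorm_ge0 x : 0 <= enorm x.
Proof. by rewrite enormE sqrtr_ge0. Qed.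

Lemma enorm_eq0 x : (enorm x == 0) = (x == 0).
Proof.
apply/eqP/eqP => [x0|->]; first by apply: dot_eq0; rewrite -enorm_sqr x0 expr0n.
by rewrite enormE -(scale0r 0) dotZl mul0r sqrtr0.
Qed.

Lemma enorm0 : enorm (0 : 'rV[R]_d) = 0.
Proof. by apply/eqP; rewrite enorm_eq0. Qed.

Lemma enorm_gt0 x : (0 < enorm x) = (x != 0).
Proof. by rewrite lt_neqAle enorm_ge0 andbT eq_sym enorm_eq0. Qed.

Lemma enormZ a x : enorm (a *: x) = `|a| * enorm x.
Proof.
by rewrite !enormE dotZl dotZr mulrA -expr2 sqrtrM ?sqr_ge0// sqrtr_sqr.
Qed.

Lemma enormN x : enorm (- x) = enorm x.
Proof. by rewrite -scaleN1r enormZ normrN1 mul1r. Qed.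

Lemma enormB x y : enorm (x - y) = enorm (y - x).
Proof. by rewrite -enormN opprB. Qed.

(** One identity serves both the Cauchy-Schwarz inequality and its equality case. *)
Lemma cauchy_schwarz_defect x y :
  dot (enorm y *: x - enorm x *: y) (enorm y *: x - enorm x *: y) =
  2 * (enorm x * enorm y) * (enorm x * enorm y - dot x y).
Proof. by rewrite !dotE (dotC y x) -!enorm_sqr; ring. Qed.

Lemma cauchy_schwarz x y : dot x y <= enorm x * enorm y.
Proof.
have [->|x0] := eqVneq x 0; first by rewrite -(scale0r 0) dotZl mul0r enormZ normr0 !mul0r.
have [->|y0] := eqVneq y 0; first by rewrite -(scale0r 0) dotZr mul0r enormZ normr0 mul0r mulr0.
have := dot_ge0 (enorm y *: x - enorm x *: y).
by rewrite cauchy_schwarz_defect pmulr_rge0 ?subr_ge0// !mulr_gt0 ?enorm_gt0.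
Qed.

Lemma enormD_sqr x y :
  enorm (x + y) ^+ 2 = enorm x ^+ 2 + 2 * dot x y + enorm y ^+ 2.
Proof. by rewrite !enorm_sqr !dotE (dotC y x); ring. Qed.

Lemma enorm_triangle x y : enorm (x + y) <= enorm x + enorm y.
Proof.
rewrite -ler_sqr ?nnegrE ?addr_ge0 ?enorm_ge0// enormD_sqr sqrrD.
by have := cauchy_schwarz x y; lra.
Qed.

(** Equality is forced in Cauchy-Schwarz, so the vector of [cauchy_schwarz_defect] vanishes. The
    division-free conclusion also covers zero vectors. *)
Lemma enorm_triangle_eq x y :
  enorm x + enorm y <= enorm (x + y) -> enorm y *: x = enorm x *: y.
Proof.
rewrite -ler_sqr ?nnegrE ?addr_ge0 ?enorm_ge0// enormD_sqr sqrrD => xy.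
have {xy} : dot x y = enorm x * enorm y.
  by apply/eqP; rewrite eq_le cauchy_schwarz; lra.
move=> dxy; apply/eqP; rewrite -subr_eq0; apply/eqP/dot_eq0.
by rewrite cauchy_schwarz_defect dxy subrr mulr0.
Qed.

(* The lower bound is Cauchy-Schwarz, the upper one AM-GM: 2tN <= N^2 + t^2. *)
Lemma enorm_far x u t : enorm u = 1 -> 0 < t ->
  - dot x u <= enorm (x - t *: u) - t <= - dot x u + dot x x / (2 * t).
Proof.
move=> u1 t0; have duu : dot u u = 1 by rewrite -enorm_sqr u1 expr1n.
apply/andP; split.
  have := cauchy_schwarz (x - t *: u) (- u).
  by rewrite !dotE enormN u1 duu; lra.
set N := enorm _; have NE : N ^+ 2 = dot x x - 2 * t * dot x u + t ^+ 2.
  by rewrite /N enorm_sqr !dotE (dotC u x) duu; ring.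
have tt0 : 0 < 2 * t by rewrite mulr_gt0.
rewrite -(ler_pM2r tt0) [leRHS]mulrDl divfK ?gt_eqF//.
have := sqr_ge0 (N - t); rewrite sqrrB NE -mulr_natr => ?; nra.
Qed.

(** At [v = t *: u] with [u] a unit vector, the sum tends to [- dot w u] as [t] grows, where [w] is
    the weighted sum of the points. Hence [dot w u >= 0] for every unit [u], and the direction
    opposite to [w] forces [w = 0]. *)
Lemma affine_dependence (s : seq (R * 'rV[R]_d)) :
  \sum_(p <- s) p.1 = 0 ->
  (forall v, \sum_(p <- s) p.1 * enorm (p.2 - v) <= 0) ->
  \sum_(p <- s) p.1 *: p.2 = 0.
Proof.
move=> s0 sle; pose w : 'rV[R]_d := \sum_(p <- s) p.1 *: p.2; rewrite -/w.
have w_ge0 u : enorm u = 1 -> 0 <= dot w u.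
  move=> u1; rewrite leNgt; apply/negP => wu0.
  pose M : R := \sum_(p <- s) `|p.1| * dot p.2 p.2.
  have M0 : 0 <= M by apply: sumr_ge0 => p _; rewrite mulr_ge0 ?dot_ge0.
  (* This [t] is large enough for the total error [M / (2 * t)] to stay below [- dot w u]. *)
  have [t t0 tE] : exists2 t : R, 0 < t & t * - dot w u = M + 1.
    exists ((M + 1) / - dot w u); first by rewrite divr_gt0 ?oppr_gt0// ltr_wpDl.
    by rewrite divfK// oppr_eq0 lt_eqF.
  have : - dot w u - M / (2 * t) <= \sum_(p <- s) p.1 * (enorm (p.2 - t *: u) - t).
    rewrite /w dot_suml /M mulr_suml -!sumrN -big_split /=; apply: ler_sum => p _.
    rewrite dotZl; have /andP[lo up] := enorm_far p.2 u1 t0.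
    have M1 : 0 <= dot p.2 p.2 / (2 * t) by rewrite divr_ge0 ?dot_ge0// mulr_ge0// ltW.
    rewrite -(mulrA `|p.1|).
    case: (leP 0 p.1) => [p0|/ltW p0].
      by rewrite (ger0_norm p0); have := ler_wpM2l p0 lo; have := mulr_ge0 p0 M1; lra.
    by rewrite (ler0_norm p0); have := ler_wnM2l p0 up; lra.
  (* Subtracting [t] from every norm changes nothing, because the weights sum to zero. *)
  have -> : \sum_(p <- s) p.1 * (enorm (p.2 - t *: u) - t) =
            \sum_(p <- s) p.1 * enorm (p.2 - t *: u).
    under eq_bigr do rewrite mulrBr.
    by rewrite big_split /= sumrN -mulr_suml s0 mul0r subr0.
  apply/negP; rewrite -ltNge (le_lt_trans (sle _))// subr_gt0.
  by rewrite ltr_pdivrMr ?mulr_gt0//; lra.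
have [//|wn0] := eqVneq w 0.
have wpos : 0 < enorm w by rewrite enorm_gt0.
have := w_ge0 (- (enorm w)^-1 *: w).
rewrite enormZ normrN gtr0_norm ?invr_gt0// mulVf ?gt_eqF// => /(_ erefl).
rewrite dotZr -enorm_sqr expr2 mulNr mulrA mulVf ?gt_eqF// mul1r.
by rewrite oppr_ge0 leNgt wpos.
Qed.

(** The norm hypothesis reverses the triangle inequality for [a *: x] and [b *: y], so for [x]
    nonzero [y = k *: x] with [k >= 0], and both are nonnegative multiples of [z]. The shorter of
    the two has factor at most 1 because [c <= a + b]. *)
Lemma segment_of_norm_le x y z a b c :
  0 < a -> 0 < b -> c <= a + b -> c *: z = a *: x + b *: y ->
  a * enorm x + b * enorm y <= c * enorm z ->
  exists2 t, 0 <= t <= 1 & x = t *: z \/ y = t *: z.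
Proof.
move=> a0 b0 cab zE nle.
have [x0|x0] := eqVneq x 0.
  by exists 0; rewrite ?lexx ?ler01//; left; rewrite scale0r.
have xgt0 : 0 < enorm x by rewrite enorm_gt0.
have c0 : 0 < c.
  have : 0 < c * enorm z.
    by apply: lt_le_trans nle; rewrite ltr_wpDr ?mulr_gt0// mulr_ge0 ?enorm_ge0// ltW.
  by rewrite ltNge; case: (ltP 0 c) => // cle; rewrite (mulr_le0_ge0 cle (enorm_ge0 z)).
have := @enorm_triangle_eq (a *: x) (b *: y).
rewrite -zE !enormZ !gtr0_norm// => /(_ nle) /eqP.
rewrite !scalerA => /eqP par.
have [k k0 yE] : exists2 k, 0 <= k & y = k *: x.
  exists (enorm y / enorm x); first by rewrite divr_ge0 ?enorm_ge0.
  apply: (scalerI (_ : a * enorm x * b != 0)).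
    by rewrite !mulf_neq0 ?gt_eqF.
  by rewrite -par scalerA; congr (_ *: _); field; rewrite gt_eqF.
have D0 : 0 < a + b * k by rewrite ltr_wpDr// mulr_ge0// ltW.
have xE : x = (c / (a + b * k)) *: z.
  apply: (scalerI (_ : a + b * k != 0)); first by rewrite gt_eqF.
  by rewrite scalerA [X in _ = X *: _]mulrC divfK ?gt_eqF// zE yE scalerA -scalerDl.
have [k1|/ltW k1] := leP 1 k.
  exists (c / (a + b * k)); last by left.
  rewrite divr_ge0 ?(ltW D0) ?(ltW c0)//= ler_pdivrMr// mul1r.
  by have := ler_wpM2l (ltW b0) k1; lra.
exists (k * (c / (a + b * k))); last by right; rewrite {1}yE {1}xE scalerA.
rewrite mulrA divr_ge0 ?mulr_ge0 ?(ltW D0) ?(ltW c0)//= ler_pdivrMr// mul1r.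
have := ler_wpM2l k0 cab; have := ler_wpM2l (ltW a0) k1; lra.
Qed.

End Euclidean.

(** * Convex hulls: sublevel sets and explicit combinations *)

Section Hull.
Variables (R : realType) (d : nat).
Implicit Types (x y z : 'rV[R]_d) (a b c : R) (A : set 'rV[R]_d).

Lemma hull_base A x : A x -> convex_hull A x.
Proof. by move=> Ax; exact: sub_gen_smallest. Qed.

(** Strict sublevel sets of a convex function are convex, so one that contains [A] contains its
    hull. *)
Lemma hull_lt A (f : 'rV[R]_d -> R) m :
  (forall x y a, 0 <= a <= 1 ->
     f (a *: x + (1 - a) *: y) <= a * f x + (1 - a) * f y) ->
  (forall x, A x -> f x < m) -> forall x, convex_hull A x -> f x < m.
Proof.
move=> fconv fA; apply: smallest_sub => //= x y l; rewrite !inE /= => fx fy.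
have [l0 l1] : 0 <= l%:num /\ l%:num <= 1 by rewrite ge0 le1.
apply: le_lt_trans (fconv _ _ _ _) _; first by rewrite l0.
have [->|ln0] := eqVneq l%:num 0; first by lra.
have lgt0 : 0 < l%:num by rewrite lt_neqAle eq_sym ln0.
have := ler_wpM2l (_ : 0 <= 1 - l%:num) (ltW fy); rewrite subr_ge0 => /(_ l1).
by move: fx; rewrite -(ltr_pM2l lgt0); lra.
Qed.

(** The weights are not normalised, so that coefficients of an affine dependence can be used as they
    are. *)
Lemma hull_convex A x y a b z : convex_hull A x -> convex_hull A y ->
  0 <= a -> 0 <= b -> 0 < a + b -> (a + b) *: z = a *: x + b *: y ->
  convex_hull A z.
Proof.
move=> Ax Ay a0 b0 ab0 zE.
have c0 : 0 <= a / (a + b) by rewrite divr_ge0 ?(ltW ab0).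
have c1 : a / (a + b) <= 1 by rewrite ler_pdivrMr// mul1r lerDl.
have -> : z = a / (a + b) *: x + (1 - a / (a + b)) *: y.
  apply: (scalerI (_ : a + b != 0)); first by rewrite gt_eqF.
  rewrite zE scalerDr !scalerA; congr (_ *: _ + _ *: _); field;
    by rewrite gt_eqF.
move=> B [cB AB].
have /(_ (Itv01 c0 c1)) := cB x y; rewrite !inE; apply.
- by apply: Ax; split.
- by apply: Ay; split.
Qed.

Lemma hull_segment A x y z t : convex_hull A x -> convex_hull A y ->
  0 <= t <= 1 -> z - x = t *: (y - x) -> convex_hull A z.
Proof.
move=> Ax Ay /andP[t0 t1] zE.
apply: (@hull_convex A x y (1 - t) t) => //; rewrite ?subr_ge0 ?subrK ?ltr01//.
rewrite scale1r -[LHS](subrK x) zE scalerBr scalerBl scale1r.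
by rewrite addrC addrA addrAC.
Qed.

Lemma hull_convex3 A x y z w a b c :
  convex_hull A x -> convex_hull A y -> convex_hull A z ->
  0 <= a -> 0 <= b -> 0 <= c -> 0 < a + b + c ->
  (a + b + c) *: w = a *: x + b *: y + c *: z -> convex_hull A w.
Proof.
move=> Ax Ay Az a0 b0 c0 abc0 wE.
have ab0 := addr_ge0 a0 b0.
have [ab00|abn0] := eqVneq (a + b) 0.
  have a00 : a = 0 by lra.
  have b00 : b = 0 by lra.
  apply: (hull_convex Ax Az (_ : 0 <= 0) c0); rewrite ?add0r//.
    by move: abc0; rewrite ab00 add0r.
  by move: wE; rewrite a00 b00 !add0r !scale0r !add0r.
have abgt0 : 0 < a + b by rewrite lt_neqAle eq_sym abn0.
pose v := (a + b)^-1 *: (a *: x + b *: y).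
have vE : (a + b) *: v = a *: x + b *: y by rewrite scalerA mulfV// scale1r.
apply: (@hull_convex A v z (a + b) c) => //; last by rewrite vE.
exact: (hull_convex Ax Ay a0 b0).
Qed.

End Hull.

(** * Distance sums, the case of four points, and the reduction to it *)

Section FourPoints.
Variables (R : realType) (d : nat).
Implicit Types (x y v : 'rV[R]_d) (vs s : seq 'rV[R]_d).

(** Lists replace multisets so that adding increments is concatenation; [dist_sum V] unfolds to
    [dsum (enum_mset V)]. *)
Definition dsum vs x : R := \sum_(v <- vs) enorm (x - v).

Lemma dsum_cat vs vs' x : dsum (vs ++ vs') x = dsum vs x + dsum vs' x.
Proof. by rewrite /dsum big_cat. Qed.

Lemma dsum_convex vs x y (a : R) : 0 <= a <= 1 ->
  dsum vs (a *: x + (1 - a) *: y) <= a * dsum vs x + (1 - a) * dsum vs y.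
Proof.
move=> /andP[a0 a1]; rewrite /dsum !mulr_sumr -big_split; apply: ler_sum => v _.
have -> : a *: x + (1 - a) *: y - v = a *: (x - v) + (1 - a) *: (y - v).
  by apply/rowP => i; rewrite !mxE; ring.
apply: le_trans (enorm_triangle _ _) _.
by rewrite !enormZ !ger0_norm ?subr_ge0.
Qed.

Lemma four_points x1 x2 x3 x4 : protrusive [:: x1; x2; x3; x4] ->
  exists vs, [/\ dsum vs x1 < dsum vs x2, dsum vs x2 < dsum vs x3 &
                 dsum vs x3 < dsum vs x4].
Proof.
move=> pro; apply: contrapT => noV.
have p2 := pro 1%N isT; have p3 := pro 2%N isT; have p4 := pro 3%N isT.
rewrite /= in p2 p3 p4.
have [||a [b [c [a0 b0 c0 abc0 abcS]]]] := @semigroup_alternative3 R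
    (fun p q r => exists vs, [/\ p = dsum vs x2 - dsum vs x1,
       q = dsum vs x3 - dsum vs x2 & r = dsum vs x4 - dsum vs x3]).
- move=> _ _ _ _ _ _ [vs [-> -> ->]] [vs' [-> -> ->]].
  by exists (vs ++ vs'); split; rewrite !dsum_cat; ring.
- move=> _ _ _ [vs [-> -> ->]]; rewrite !subr_gt0 => lt12 lt23.
  by rewrite leNgt subr_gt0; apply/negP => lt34; apply: noV; exists vs.
have H v : - a * enorm (x1 - v) + (a - b) * enorm (x2 - v) +
           (b - c) * enorm (x3 - v) + c * enorm (x4 - v) <= 0.
  have := abcS _ _ _ (ex_intro _ [:: v] (And3 erefl erefl erefl)).
  by rewrite /dsum !big_seq1; lra.
have dep : - a *: x1 + (a - b) *: x2 + (b - c) *: x3 + c *: x4 = 0.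
  have := @affine_dependence R d [:: (- a, x1); (a - b, x2); (b - c, x3); (c, x4)].
  rewrite !big_cons !big_nil /= !addr0 !addrA; apply; first by ring.
  by move=> v; rewrite !big_cons !big_nil /= !addr0 !addrA.
have h21 : convex_hull [set x | x \in [:: x1]] x1.
  by apply: hull_base; rewrite /= inE eqxx.
have [h31 h32] : convex_hull [set x | x \in [:: x1; x2]] x1 /\
                 convex_hull [set x | x \in [:: x1; x2]] x2.
  by split; apply: hull_base; rewrite /= !inE eqxx ?orbT.
have [h41 h42 h43] : [/\ convex_hull [set x | x \in [:: x1; x2; x3]] x1,
   convex_hull [set x | x \in [:: x1; x2; x3]] x2 &
   convex_hull [set x | x \in [:: x1; x2; x3]] x3].
  by split; apply: hull_base; rewrite /= !inE eqxx ?orbT.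
have x21 : x2 != x1 by apply/eqP => e; apply: p2; rewrite e.
have x31 : x3 != x1 by apply/eqP => e; apply: p3; rewrite e.
have x41 : x4 != x1 by apply/eqP => e; apply: p4; rewrite e.
have n21 : 0 < enorm (x2 - x1) by rewrite enorm_gt0 subr_eq0.
have n31 : 0 < enorm (x3 - x1) by rewrite enorm_gt0 subr_eq0.
have n41 : 0 < enorm (x4 - x1) by rewrite enorm_gt0 subr_eq0.
have H1 := H x1; rewrite subrr enorm0 mulr0 add0r in H1.
have coord i := congr1 (fun u : 'rV[R]_d => u ord0 i) dep.
(* For [c = 0]: if [b <= a], the left side of [H1] is positive; otherwise the dependence puts [x3]
   on the segment from [x1] to [x2]. *)
have [c00|cn0] := eqVneq c 0.
  have [ba|ab] := leP b a.
    have t2 : 0 <= (a - b) * enorm (x2 - x1) by rewrite mulr_ge0 ?subr_ge0// ltW.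
    have [b00|bn0] := eqVneq b 0.
      have : 0 < (a - b) * enorm (x2 - x1) by rewrite mulr_gt0//; lra.
      by rewrite b00 c00 in H1 *; lra.
    have : 0 < b * enorm (x3 - x1) by rewrite mulr_gt0// lt_neqAle eq_sym bn0.
    by rewrite c00 in H1 *; lra.
  apply: p3; apply: (hull_convex h31 h32 a0 (_ : 0 <= b - a)).
  - by lra.
  - by lra.
  by apply/rowP => i; have := coord i; rewrite c00 !mxE; lra.
have {cn0} cgt0 : 0 < c by rewrite lt_neqAle eq_sym cn0.
have [ba|ab] := leP b a; have [cb|bc] := leP c b.
(* Signs [-+++]: no term of [H1] is negative and the last one is positive. *)
- have t2 : 0 <= (a - b) * enorm (x2 - x1) by rewrite mulr_ge0 ?subr_ge0// ltW.
  have t3 : 0 <= (b - c) * enorm (x3 - x1) by rewrite mulr_ge0 ?subr_ge0// ltW.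
  by have := mulr_gt0 cgt0 n41; lra.
(* Signs [-+-+]: here [x2] on the segment from [x1] to [x3] violates nothing by itself, since [x2]
   comes before [x3]. *)
- have [ab|ab] := eqVneq a b.
    apply: p4; apply: (hull_convex h41 h43 a0 (_ : 0 <= c - b)).
    + by lra.
    + by lra.
    by apply/rowP => i; have := coord i; rewrite ab !mxE; lra.
  have abgt : 0 < a - b by rewrite subr_gt0 lt_neqAle eq_sym ab.
  have zE : (c - b) *: (x3 - x1) = (a - b) *: (x2 - x1) + c *: (x4 - x1).
    by apply/rowP => i; have := coord i; rewrite !mxE; lra.
  have [||t t01 [x2E|x4E]] := segment_of_norm_le abgt cgt0 _ zE; [lra|lra| |].
    (* x2 lies on [x1, x3], so x4 = x1 + k (x3 - x1) is on that line as well;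
       v = x1 gives 0 <= k and v = x3 gives k <= 1. *)
    pose k := ((c - b) - (a - b) * t) / c.
    have kE : c * k = (c - b) - (a - b) * t by rewrite mulrC divfK ?gt_eqF.
    have x4E : x4 - x1 = k *: (x3 - x1).
      apply: (scalerI (_ : c != 0)); first by rewrite gt_eqF.
      rewrite [RHS]scalerA kE scalerBl -scalerA -x2E zE.
      by rewrite addrAC subrr add0r.
    have x43E : x4 - x3 = (k - 1) *: (x3 - x1).
      by rewrite scalerBl scale1r -x4E; apply/rowP => i; rewrite !mxE; ring.
    have x23E : x2 - x3 = (t - 1) *: (x3 - x1).
      by rewrite scalerBl scale1r -x2E; apply/rowP => i; rewrite !mxE; ring.
    case/andP: t01 => t0 t1.
    have k0 : 0 <= k.
      move: H1; rewrite x2E x4E !enormZ (ger0_norm t0) => H1.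
      have : ((a - b) * t + (b - c) + c * `|k|) * enorm (x3 - x1) <= 0 by lra.
      (* By [kE], the bound [H2] reads [c * |k| <= c * k]. *)
      rewrite pmulr_lle0// => H2.
      have : `|k| <= k by rewrite -(ler_pM2l cgt0); lra.
      exact: le_trans (normr_ge0 _).
    have k1 : k <= 1.
      have := H x3; rewrite subrr enorm0 mulr0 addr0 x23E x43E !enormZ.
      rewrite (enormB x1) (ler0_norm (_ : t - 1 <= 0)) ?subr_le0// => H3.
      have : (- a + (a - b) * (1 - t) + c * `|k - 1|) * enorm (x3 - x1) <= 0 by lra.
      (* By [kE], the bound [H2] now reads [c * |k - 1| <= c * (1 - k)]. *)
      rewrite pmulr_lle0// => H2.
      have : `|k - 1| <= 1 - k by rewrite -(ler_pM2l cgt0); lra.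
      by move/(le_trans (normr_ge0 _)); rewrite subr_ge0.
    by apply: p4; apply: (hull_segment h41 h43 _ x4E); rewrite k0.
  by apply: p4; exact: (hull_segment h41 h43 t01 x4E).
(* Signs [--++]: either outcome of [segment_of_norm_le] puts a later point between [x1] and [x2]. *)
- have [cb'|cb'] := eqVneq c b.
    apply: p4; apply: (hull_convex h41 h42 a0 (_ : 0 <= b - a)).
    + by lra.
    + by lra.
    by apply/rowP => i; have := coord i; rewrite cb' !mxE; lra.
  have bcgt : 0 < b - c by rewrite subr_gt0 lt_neqAle cb'.
  have zE : (b - a) *: (x2 - x1) = (b - c) *: (x3 - x1) + c *: (x4 - x1).
    by apply/rowP => i; have := coord i; rewrite !mxE; lra.
  have [||t t01 [x3E|x4E]] := segment_of_norm_le bcgt cgt0 _ zE; [lra|lra| |].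
    by apply: p3; exact: (hull_segment h31 h32 t01 x3E).
  by apply: p4; exact: (hull_segment h41 h42 t01 x4E).
(* Signs [---+]: the dependence itself writes [x4] as a convex combination. *)
- apply: p4; apply: (hull_convex3 h41 h42 h43 a0 (_ : 0 <= b - a) (_ : 0 <= c - b)).
  + by lra.
  + by lra.
  + by lra.
  by apply/rowP => i; have := coord i; rewrite !mxE; lra.
Qed.

(** A point whose first coordinate exceeds those of all earlier points lies outside their hull. *)
Lemma protrusive_rcons s : (0 < d)%N -> protrusive s ->
  exists x, protrusive (rcons s x).
Proof.
move=> d0 ps; pose j := Ordinal d0.
have [m mP] : exists m : R, forall y, y \in s -> y ord0 j < m.
  elim: s {ps} => [|y s [m mP]]; first by exists 0.
  exists (Num.max m (y ord0 j + 1)) => z; rewrite inE => /orP[/eqP ->|/mP zm].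
    by rewrite lt_max ltrDl ltr01 orbT.
  by rewrite lt_max zm.
exists (const_mx m) => i; rewrite size_rcons ltnS => /andP[i0 il].
rewrite -cats1 takel_cat// nth_cat; case: ltnP => [ilt|ige].
  by apply: ps; rewrite i0.
have -> : i = size s by apply/eqP; rewrite eqn_leq il.
rewrite take_size subnn /= => hull_m.
have := @hull_lt _ _ _ (fun y => y ord0 j) m _ mP _ hull_m.
rewrite mxE ltxx => contra; suff: false by []; apply: contra => x y a _.
by rewrite !mxE.
Qed.

Lemma protrusive_extend k s : (0 < d)%N -> protrusive s ->
  exists s', size s' = k /\ protrusive (s ++ s').
Proof.
move=> d0; elim: k s => [|k IHk] s ps; first by exists [::]; rewrite cats0.
have [x /IHk[s' [ss' ps']]] := protrusive_rcons d0 ps.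
by exists (x :: s'); rewrite /= ss' -cat_rcons.
Qed.

(** On the hull of the earlier points, the convex function [dsum vs] stays below its value at the
    next point. *)
Lemma sorted_protrusive vs s :
  sorted (fun x y => dsum vs x < dsum vs y) s -> protrusive s.
Proof.
move=> ss i /andP[i0 ilt] hull_i.
have tr : transitive (fun x y => dsum vs x < dsum vs y).
  by move=> ? ? ?; exact: lt_trans.
suff : dsum vs (nth 0 s i) < dsum vs (nth 0 s i) by rewrite ltxx.
apply: hull_lt hull_i => [x y a|x /= /(nthP 0)[j]]; first exact: dsum_convex.
rewrite size_takel ?(ltnW ilt)// => ji <-; rewrite nth_take//.
by apply: (sorted_ltn_nth tr); rewrite ?inE// (ltn_trans ji).
Qed.

Lemma dist_sum_seq_mset vs x : dist_sum (seq_mset vs) x = dsum vs x.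
Proof. exact/perm_big/perm_eq_seq_mset. Qed.

Lemma protrusive_sorted s : (0 < d)%N -> (size s <= 4)%N -> protrusive s ->
  exists V : {mset 'rV[R]_d}%mset, V <> mset0 /\
    sorted (fun x y => dist_sum V x < dist_sum V y) s.
Proof.
move=> d0 s4 ps; have [s' [ss' ps']] := protrusive_extend (4 - size s) d0 ps.
have : size (s ++ s') = 4 by rewrite size_cat ss' subnKC.
case E : (s ++ s') ps' => [|x1 [|x2 [|x3 [|x4 [|? ?]]]]] //.
move=> /four_points[vs [lt12 lt23 lt34]] _.
exists (seq_mset vs); split.
  (* The empty multiset has all distance sums zero, against the strict inequality [lt12]. *)
  move=> V0; move: lt12; rewrite -!dist_sum_seq_mset V0.
  by rewrite /dist_sum enum_mset0 !big_nil ltxx.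
have : sorted (fun x y => dist_sum (seq_mset vs) x < dist_sum (seq_mset vs) y) (s ++ s').
  by rewrite E /= !dist_sum_seq_mset lt12 lt23 lt34.
(* The added points come last, so [s] is a prefix of a sorted list. *)
by case/cat_sorted2.
Qed.

Lemma sorted_lt_inj (f : 'rV[R]_d -> R) s :
  sorted (fun x y => f x < f y) s -> {in s &, injective f}.
Proof.
move=> ss x y xs ys fxy.
have tr : transitive (fun x y => f x < f y) by move=> ? ? ?; exact: lt_trans.
have lt_index u v : u \in s -> v \in s -> (index u s < index v s)%N -> f u < f v.
  exact: (sorted_ltn_index tr ss).
have [ixy|ixy|] := ltngtP (index x s) (index y s).
- by have := lt_index _ _ xs ys ixy; rewrite fxy ltxx.
- by have := lt_index _ _ ys xs ixy; rewrite fxy ltxx.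
- by move/(congr1 (nth 0 s)); rewrite !nth_index.
Qed.

End FourPoints.

Local Open Scope fset_scope.
Local Open Scope ring_scope.

Theorem theorem7p4 (R : realType) (d : nat) (hd : (1 <= d)%N)
    (C : {fset 'rV[R]_d}) (hC : (#|` C| <= 4)%N) :
  Psi C = [set s | ordering C s /\ protrusive s].
Proof.
apply/seteqP; split=> [s [V [_ [_ Cs ss]]]|s [[us sC] ps]] /=.
  by split=> //; exact: sorted_protrusive ss.
have s4 : (size s <= 4)%N.
  by apply: leq_trans hC; apply: uniq_leq_size us _ => x; rewrite sC.
have [V [V0 ss]] := protrusive_sorted hd s4 ps.
exists V; split=> //; split=> // x y xC yC.
by apply: (sorted_lt_inj ss); rewrite sC.
Qed.
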